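(* Assume (f6). Then the functional $\Upsilon:E_{\Phi_1}(\mathbb{R}^N)\to\mathbb{R}$, $\Upsilon(u)=\int_{\mathbb{R}^N}F(x,u)\,dx$, is well defined and locally Lipschitz on $E_{\Phi_1}(\mathbb{R}^N)$.
   Context: Let $N\ge3$. $f:\mathbb{R}^N\times\mathbb{R}\to\mathbb{R}$ is measurable and locally bounded, $F(x,t)=\int_0^tf(x,s)ds$, $\underline f(x,t)=\lim_{\delta\to0}\operatorname{ess\,inf}_{|s-t|<\delta}f(x,s)$, $\overline f(x,t)=\lim_{\delta\to0}\operatorname{ess\,sup}_{|s-t|<\delta}f(x,s)$, $\partial_tF(x,t)=[\underline f(x,t),\overline f(x,t)]$. Let $\Phi(t)=e^t-\sum_{j=0}^{N-2}t^j/j!$. (f6): there are $\alpha_0,c_1,c_2>0$ with $|\xi|\le c_1|t|^{N-1}+c_2\Phi(\alpha_0|t|^{N/(N-1)})$ for all $\xi\in\partial_tF(x,t)$, $t\in\mathbb{R}$, $x\in\mathbb{R}^N$. Let $\Phi_1(t)=\exp(|t|^{N/(N-1)})-\sum_{j=0}^{N-2}|t|^{Nj/(N-1)}/j!$; $L^{\Phi_1}(\mathbb{R}^N)=\{u\in L^1_{loc}:\int\Phi_1(|u|/\lambda)dx<\infty\text{ for some }\lambda>0\}$ with Luxemburg norm $\|u\|_{\Phi_1}=\inf\{\lambda>0:\int\Phi_1(|u|/\lambda)dx\le1\}$; $E_{\Phi_1}(\mathbb{R}^N)$ is the closure in $L^{\Phi_1}$ of the functions with bounded support, equipped with $\|\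cdot\|_{\Phi_1}$.
   Formalization: E_{Φ1} is taken as the closure of the bounded functions with bounded support (with unbounded ones Υ can be infinite, e.g. u=c(log 1/|x|)^{(N-1)/N} near 0); measurable means Borel measurable, which suffices up to changes on null sets. *)

(* Defs.v *)
From HB Require Import structures.
From mathcomp Require Import all_boot all_order all_algebra.
From mathcomp Require Import all_classical all_reals all_analysis.
Set Implicit Arguments.
Unset Strict Implicit.
Unset Printing Implicit Defensive.
Import Order.TTheory GRing.Theory Num.Def Num.Theory.
Import numFieldNormedType.Exports.
Local Open Scope classical_set_scope.
Local Open Scope ring_scope.

(** R^(n+1) = R * (R * ( ... * R)) with the product (Borel) sigma-algebra *)
Fixpoint RS (R : realType) (n : nat) : {d : measure_display & measurableType d} :=
  match n with
  | 0 => existT (fun d => measurableType d) _ (measurableTypeR R)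
  | m.+1 => existT (fun d => measurableType d) _ ((measurableTypeR R * projT2 (RS R m))%type : measurableType _)
  end.

(** Product of Lebesgue measure on R with a sigma-finite measure; we wrap it
   in a new constant so that its (library-proved) measure structure and its
   sigma-finiteness can be declared canonically. *)
Section lebprod.
Local Open Scope ereal_scope.
Context (R : realType) (d : measure_display) (T : measurableType d)
  (mu : {sigma_finite_measure set T -> \bar R}).

Definition lebprod : set (measurableTypeR R * T)%type -> \bar R :=
  (@lebesgue_measure R \x mu)%E.

HB.instance Definition _ := Measure.copy lebprod (@lebesgue_measure R \x mu)%E.

Lemma lebprod_sigma_finite : sigma_finite setT lebprod.
Proof.
have /sigma_finiteP[F [TF ndF Foo]] := sigma_finiteT (@lebesgue_measure R).
have /sigma_finiteP[G [TG ndG Goo]] := sigma_finiteT mu.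
exists (fun n => F n `*` G n).
  rewrite -setXTT TF TG predeqE => -[x y]; split.
    move=> [/= [n _ Fnx] [k _ Gky]]; exists (maxn n k) => //; split.
    - by move: x Fnx; exact/subsetPset/ndF/leq_maxl.
    - by move: y Gky; exact/subsetPset/ndG/leq_maxr.
  by move=> [n _ []/= ? ?]; split; exists n.
move=> k; have [? ?] := Foo k; have [? ?] := Goo k.
split; first exact: measurableX.
by rewrite /lebprod product_measure1E// lte_mul_pinfty// ge0_fin_numE.
Qed.

HB.instance Definition _ := Measure_isSigmaFinite.Build _ _ _ lebprod
  lebprod_sigma_finite.
End lebprod.

(** Lebesgue measure on R^(n+1): iterated product of Lebesgue measure on R
    (defined on the product Borel sigma-algebra) *)
Fixpoint lebS (R : realType) (n : nat) :
    {sigma_finite_measure set (projT2 (RS R n)) -> \bar R} :=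
  match n return {sigma_finite_measure set (projT2 (RS R n)) -> \bar R} with
  | 0 => @lebesgue_measure R
  | m.+1 => lebprod (lebS R m)
  end.

Fixpoint sqnormS (R : realType) (n : nat) : projT2 (RS R n) -> R :=
  match n return projT2 (RS R n) -> R with
  | 0 => fun x : R => x ^+ 2
  | m.+1 => fun x => x.1 ^+ 2 + @sqnormS R m x.2
  end.

(** The Euclidean space R^N (meaningful for N >= 1), its Lebesgue measure, its norm *)
Definition RN (R : realType) (N : nat) : measurableType (projT1 (RS R N.-1)) :=
  projT2 (RS R N.-1).
Definition lebN (R : realType) (N : nat) := lebS R N.-1.
Definition eucl (R : realType) (N : nat) (x : RN R N) : R :=
  Num.sqrt (@sqnormS R N.-1 x).

Definition Phi (R : realType) (N : nat) (t : R) : R :=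
  expR t - \sum_(j < N.-1) t ^+ j / (j`!)%:R.

Definition Phi1 (R : realType) (N : nat) (t : R) : R :=
  expR (`|t| `^ (N%:R / (N.-1)%:R))
  - \sum_(j < N.-1) `|t| `^ ((N * j)%:R / (N.-1)%:R) / (j`!)%:R.

Definition modular1 (R : realType) (N : nat) (u : RN R N -> R) (lam : R) : \bar R :=
  (\int[lebN R N]_x (Phi1 N (`|u x| / lam))%:E)%E.

Definition L1loc (R : realType) (N : nat) (u : RN R N -> R) : Prop :=
  measurable_fun [set: RN R N] u /\
  forall r : R, 0 < r -> (lebN R N).-integrable [set x | eucl x <= r] (EFin \o u).

Definition in_LPhi1 (R : realType) (N : nat) (u : RN R N -> R) : Prop :=
  L1loc u /\ exists lam : R, 0 < lam /\ (modular1 u lam < +oo)%E.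

Definition lux_norm (R : realType) (N : nat) (u : RN R N -> R) : R :=
  inf [set lam : R | 0 < lam /\ (modular1 u lam <= 1)%E].

Definition bdd_bdd_supp (R : realType) (N : nat) (u : RN R N -> R) : Prop :=
  (exists M : R, forall x, `|u x| <= M) /\
  (exists r : R, forall x, r < eucl x -> u x = 0).

Definition in_EPhi1 (R : realType) (N : nat) (u : RN R N -> R) : Prop :=
  in_LPhi1 u /\
  forall eps : R, 0 < eps -> exists v : RN R N -> R,
    [/\ in_LPhi1 v, bdd_bdd_supp v & lux_norm (u \- v) < eps].

Definition locally_bounded (R : realType) (N : nat) (f : RN R N -> R -> R) : Prop :=
  forall r : R, 0 < r -> exists M : R,
    forall x t, eucl x <= r -> `|t| <= r -> `|f x t| <= M.

Definition Fprim (R : realType) (N : nat) (f : RN R N -> R -> R) (x : RN R N) (t : R) : R :=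
  if 0 <= t then Rintegral (@lebesgue_measure R) `[0, t]%classic (f x)
  else - Rintegral (@lebesgue_measure R) `[t, 0]%classic (f x).

Definition essinf_on (R : realType) (D : set R) (g : R -> R) : \bar R :=
  ereal_sup [set y : \bar R | \forall s \ae (@lebesgue_measure R), D s -> (y <= (g s)%:E)%E].
Definition esssup_on (R : realType) (D : set R) (g : R -> R) : \bar R :=
  ereal_inf [set y : \bar R | \forall s \ae (@lebesgue_measure R), D s -> ((g s)%:E <= y)%E].

Definition f_low (R : realType) (N : nat) (f : RN R N -> R -> R) (x : RN R N) (t : R) : \bar R :=
  lim ((fun delta : R => essinf_on `](t - delta), (t + delta)[%classic (f x)) @ 0^'+).
Definition f_up (R : realType) (N : nat) (f : RN R N -> R -> R) (x : RN R N) (t : R) : \bar R :=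
  lim ((fun delta : R => esssup_on `](t - delta), (t + delta)[%classic (f x)) @ 0^'+).

(** (f6): growth bound on the generalized gradient [f_low, f_up] = d_t F *)
Definition cond_f6 (R : realType) (N : nat) (f : RN R N -> R -> R) : Prop :=
  exists alpha0 c1 c2 : R, [/\ 0 < alpha0, 0 < c1, 0 < c2 &
    forall (x : RN R N) (t xi : R),
      (f_low f x t <= xi%:E)%E -> (xi%:E <= f_up f x t)%E ->
      `|xi| <= c1 * `|t| ^+ N.-1 + c2 * Phi N (alpha0 * `|t| `^ (N%:R / (N.-1)%:R))].

Definition Upsilon (R : realType) (N : nat) (f : RN R N -> R -> R) (u : RN R N -> R) : R :=
  Rintegral (lebN R N) [set: RN R N] (fun x => Fprim f x (u x)).

(* Main.v *)
Require Import Defs.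
From HB Require Import structures.
From mathcomp Require Import all_boot all_order all_algebra.
From mathcomp Require Import all_classical all_reals all_analysis.
From mathcomp Require Import measurable_realfun ring lra.
Set Implicit Arguments.
Unset Strict Implicit.
Unset Printing Implicit Defensive.
Import Order.TTheory GRing.Theory Num.Def Num.Theory.
Import numFieldNormedType.Exports.
Local Open Scope classical_set_scope.
Local Open Scope ring_scope.

(** For fixed [x], (f6) bounds the lower and upper limits of [f x] on a
    neighbourhood of each point, hence [|f x s| <= G M] for almost every
    [|s| <= M], where [G] is the (increasing) right-hand side of (f6). Thus
    [|F(x,a) - F(x,b)| <= |a - b| G(max |a| |b|)]. Writing
    [|a - b| = beta l k] and [t = max(k, |a|, |b|)] with [beta = alpha0 + 1], one has
    [k G(M) <= t G(t) <= C Phi1(beta t)], and the maximum splits into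
    [Phi1((a - b) / l) + Phi1(beta a) + Phi1(beta b)]: this replaces Hoelder's
    inequality. It remains to bound [int Phi1(beta v)] uniformly for [v] near
    [u] in E_Phi1, which follows by splitting
    [v = (v - u) + (u - z) + z] with [z] bounded. *)

(** * Inequalities for the truncated exponential [Phi], read off its power series *)

Section Phi_theory.
Context {R : realType}.
Implicit Types (n m N : nat) (x y a s t : R).

(** For [n = N.-1] these are the partial sums of the power series of [Phi N]; [m] counts the
    terms. *)
Definition exp_tail n x m : R := \sum_(n <= j < n + m) x ^+ j / j`!%:R.

Lemma exp_tailS n x m :
  exp_tail n x m.+1 = exp_tail n x m + x ^+ (n + m) / (n + m)`!%:R.
Proof. by rewrite /exp_tail addnS big_nat_recr//= leq_addr. Qed.

Lemma exp_tail0 n x : exp_tail n x 0 = 0.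
Proof. by rewrite /exp_tail addn0 big_geq. Qed.

Lemma cvg_exp_tail N x : exp_tail N.-1 x @ \oo --> Phi N x.
Proof.
set n := N.-1.
have h : series (exp_coeff x) @ \oo --> expR x := is_cvg_series_exp_coeff x.
rewrite -(cvg_shiftn n) in h.
have -> : exp_tail n x =
    (fun m => series (exp_coeff x) (m + n)%N - \sum_(j < n) x ^+ j / j`!%:R).
  apply/funext => m; rewrite /series/= (@big_cat_nat _ _ _ n)//= ?leq_addl//.
  by rewrite big_mkord addrAC subrr add0r addnC.
by apply: cvgB; [exact: h | exact: cvg_cst].
Qed.

(** The shifts [k] and [k'] allow partial sums of different lengths on the two sides, as [Phi_add]
    requires. *)
Lemma ler_Phi_tail N N' x y c c' k k' :
  (forall m, c * exp_tail N.-1 x (m + k) <= c' * exp_tail N'.-1 y (m + k')) ->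
  c * Phi N x <= c' * Phi N' y.
Proof.
move=> h.
have cv M z e l : (fun m => e * exp_tail M.-1 z (m + l)%N) @ \oo --> e * Phi M z.
  apply: cvgM; first exact: cvg_cst.
  by have := @cvg_exp_tail M z; rewrite -(cvg_shiftn l).
by apply: (ler_cvg_to (cv N x c k) (cv N' y c' k')); apply: nearW.
Qed.

Lemma Phi_ge0 N x : 0 <= x -> 0 <= Phi N x.
Proof.
move=> x0; rewrite -[Phi N x]mul1r -(mul0r (Phi N x)).
apply: (@ler_Phi_tail _ _ _ _ _ _ 0 0) => m; rewrite mul0r mul1r.
by apply: sumr_ge0 => j _; rewrite divr_ge0// exprn_ge0.
Qed.

Lemma ler_Phi N x y : 0 <= x -> x <= y -> Phi N x <= Phi N y.
Proof.
move=> x0 xy; rewrite -[leLHS]mul1r -[leRHS]mul1r.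
apply: (@ler_Phi_tail _ _ _ _ _ _ 0 0) => m; rewrite !mul1r.
by apply: ler_sum => j _; rewrite ler_wpM2r ?invr_ge0// lerXn2r// nnegrE// (le_trans x0).
Qed.

(** Every term of the series has degree [j >= N.-1], where [s ^+ j <= s ^+ N.-1]. *)
Lemma Phi_scale N x s : 0 <= x -> 0 <= s -> s <= 1 ->
  Phi N (s * x) <= s ^+ N.-1 * Phi N x.
Proof.
move=> x0 s0 s1; rewrite -[leLHS]mul1r.
apply: (@ler_Phi_tail _ _ _ _ _ _ 0 0) => m; rewrite mul1r /exp_tail big_distrr/=.
rewrite big_nat [leRHS]big_nat; apply: ler_sum => j /andP[nj _].
rewrite exprMn mulrA ler_wpM2r ?invr_ge0// ler_wpM2r ?exprn_ge0//.
by rewrite ler_wiXn2l.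
Qed.

(** The left side is the leading term of a series with nonnegative terms. *)
Lemma expr_fact_le_Phi N x : 0 <= x -> x ^+ N.-1 / N.-1`!%:R <= Phi N x.
Proof.
move=> x0; have h := @cvg_exp_tail N x; rewrite -(cvg_shiftn 1) in h.
apply: (ler_cvg_to (cvg_cst _) h); apply: nearW => m /=.
rewrite addn1; elim: m => [|m IH]; first by rewrite exp_tailS exp_tail0 add0r addn0.
by rewrite exp_tailS (le_trans IH)// lerDl divr_ge0// exprn_ge0.
Qed.

(** Bernoulli's inequality in homogeneous form: the first two terms of the binomial expansion. *)
Lemma exprD_ge_linear a s n : 0 <= a -> 0 <= s ->
  a ^+ n.+1 + n.+1%:R * a ^+ n * s <= (a + s) ^+ n.+1.
Proof.
move=> a0 s0; elim: n => [|n IH]; first by rewrite !expr1 expr0 !mul1r.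
rewrite [leRHS]exprS.
apply: (@le_trans _ _ ((a + s) * (a ^+ n.+1 + n.+1%:R * a ^+ n * s))); last first.
  by rewrite ler_wpM2l// addr_ge0.
rewrite -subr_ge0; have := exprn_ge0 n a0; set z := a ^+ n => z0.
have -> : (a + s) * (a ^+ n.+1 + n.+1%:R * z * s) -
  (a ^+ n.+2 + n.+2%:R * a ^+ n.+1 * s) = n.+1%:R * z * s ^+ 2.
  by rewrite !exprS -/z -(natr1 n.+1) ; ring.
by rewrite !mulr_ge0 // ?exprn_ge0.
Qed.

(** By [exprD_ge_linear], the term of degree [j + 1] on the right dominates the one of degree
    [j + 1] in [Phi N a] plus [s] times the one of degree [j]. *)
Lemma Phi_add N a s : 0 <= a -> 0 <= s -> (1 + s) * Phi N a <= Phi N (a + s).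
Proof.
move=> a0 s0; rewrite -[leRHS]mul1r; set n := N.-1.
apply: (@ler_Phi_tail _ _ _ _ _ _ 0 1) => m; rewrite mul1r addn0 addn1 -/n.
(* One more term in the summand without [s] aligns the degrees for the induction. *)
apply: (@le_trans _ _ (exp_tail n a m.+1 + s * exp_tail n a m)).
  rewrite mulrDl mul1r lerD2r exp_tailS lerDl divr_ge0// exprn_ge0//.
elim: m => [|m IH].
  rewrite !exp_tailS !exp_tail0 mulr0 addr0 !add0r addn0 ler_wpM2r ?invr_ge0//.
  by rewrite lerXn2r ?nnegrE ?addr_ge0// lerDl.
rewrite (exp_tailS n a m.+1) [X in s * X]exp_tailS [leRHS]exp_tailS mulrDr addrACA lerD//.
rewrite addnS factS natrM.
have f0 : (n + m)`!%:R != 0 :> R by rewrite pnatr_eq0 -lt0n fact_gt0.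
have k0 : (n + m).+1%:R != 0 :> R by rewrite pnatr_eq0.
have -> : s * (a ^+ (n + m) / (n + m)`!%:R) =
  ((n + m).+1%:R * (a ^+ (n + m) * s)) / ((n + m).+1%:R * (n + m)`!%:R).
  by rewrite -mulf_div divff// mul1r mulrA [s * _]mulrC.
by rewrite -mulrDl ler_wpM2r ?invr_ge0 ?mulr_ge0// mulrA exprD_ge_linear.
Qed.

End Phi_theory.

(** * The function [Phi1], that is [Phi] after the power [p = N / (N - 1)] *)

Section Phi1_theory.
Context {R : realType} {N : nat} (N3 : (3 <= N)%N).
Implicit Types (s t : R).
Let p : R := N%:R / N.-1%:R.

Let n_neq0 : N.-1%:R != 0 :> R.
Proof. by rewrite pnatr_eq0; case: N N3 => [|[|[]]]. Qed.

Let p_ge0 : 0 <= p. Proof. by rewrite divr_ge0. Qed.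

Let p_ge1 : 1 <= p.
Proof.
rewrite ler_pdivlMr ?mul1r ?ler_nat ?leq_pred//.
by rewrite lt_neqAle eq_sym n_neq0 ler0n.
Qed.

Let powRpX t : 0 <= t -> (t `^ p) ^+ N.-1 = t ^+ N.
Proof.
by move=> t0; rewrite -powR_mulrn ?powR_ge0// -powRrM divfK// powR_mulrn.
Qed.

Let ler_powRp s t : 0 <= s -> s <= t -> s `^ p <= t `^ p.
Proof. by move=> s0 st; rewrite ge0_ler_powR// nnegrE// (le_trans s0). Qed.

Lemma Phi1E t : Phi1 N t = Phi N (`|t| `^ p).
Proof.
rewrite /Phi1 /Phi; congr (_ - _); apply: eq_bigr => j _.
by rewrite -powR_mulrn ?powR_ge0// -powRrM natrM mulrAC.
Qed.

Lemma Phi1_abs t : Phi1 N `|t| = Phi1 N t.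
Proof. by rewrite /Phi1 normr_id. Qed.

Lemma Phi1_ge0 t : 0 <= Phi1 N t.
Proof. by rewrite Phi1E Phi_ge0// powR_ge0. Qed.

Lemma ler_Phi1 s t : `|s| <= `|t| -> Phi1 N s <= Phi1 N t.
Proof. by move=> st; rewrite !Phi1E ler_Phi ?powR_ge0// ler_powRp. Qed.

Lemma expr_le_Phi1 t : `|t| ^+ N <= N.-1`!%:R * Phi1 N t.
Proof.
rewrite mulrC -ler_pdivrMr ?ltr0n ?fact_gt0// Phi1E -powRpX//.
by rewrite expr_fact_le_Phi// powR_ge0.
Qed.

(** [Phi_scale] with factor [s ^ p], whose power [N - 1] is [s ^ N]. *)
Lemma Phi1_scale s t : 0 <= s -> s <= 1 -> Phi1 N (s * t) <= s ^+ N * Phi1 N t.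
Proof.
move=> s0 s1; rewrite !Phi1E normrM (ger0_norm s0) powRM//.
rewrite (le_trans (Phi_scale _ _ _ _))// ?powR_ge0//; last by rewrite powRpX.
by have := ler_powRp s0 s1; rewrite powR1.
Qed.

Lemma Phi1_max s t : Phi1 N (Num.max `|s| `|t|) <= Phi1 N s + Phi1 N t.
Proof.
by case: (leP `|s| `|t|) => _; rewrite Phi1_abs ?lerDl ?lerDr Phi1_ge0.
Qed.

(** [|s + t|] is at most twice the larger of [|s|] and [|t|]; monotonicity thus stands in for
    convexity. *)
Lemma Phi1_add s t : Phi1 N (s + t) <= Phi1 N (2 * s) + Phi1 N (2 * t).
Proof.
apply: le_trans (Phi1_max _ _); apply: ler_Phi1; rewrite [leRHS]ger0_norm; last first.
  by rewrite le_max normr_ge0.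
rewrite !normrM (ger0_norm (ler0n _ 2)) (le_trans (ler_normD _ _))//.
by rewrite le_max; case: (leP `|s| `|t|) => ?; apply/orP; [right | left]; lra.
Qed.

(* [t <= 1 + t ^ p] and [Phi_add] absorb the extra factor [t]. *)
Lemma growth_le_Phi1 alpha c1 c2 t : 0 < alpha -> 0 <= c1 -> 0 <= c2 -> 0 <= t ->
  t * (c1 * t ^+ N.-1 + c2 * Phi N (alpha * t `^ p)) <=
    (c1 * N.-1`!%:R + c2) * Phi1 N ((alpha + 1) * t).
Proof.
move=> a0 c10 c20 t0; have a1 : 1 <= alpha + 1 by rewrite lerDr ltW.
have aE : alpha + 1 = `|alpha + 1| by rewrite ger0_norm// (le_trans _ a1).
rewrite mulrDr mulrDl; apply: lerD.
  rewrite mulrCA -exprS prednK ?(leq_trans _ N3)// -mulrA ler_wpM2l//.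
  rewrite (le_trans _ (expr_le_Phi1 _))// normrM -aE (ger0_norm t0).
  by rewrite lerXn2r ?nnegrE ?mulr_ge0 ?(le_trans _ a1)// ler_peMl.
rewrite mulrCA ler_wpM2l// Phi1E normrM -aE (ger0_norm t0).
apply: (@le_trans _ _ (Phi N (alpha * t `^ p + t `^ p))).
  have s0 : 0 <= alpha * t `^ p by rewrite mulr_ge0 ?powR_ge0// ltW.
  apply: le_trans (Phi_add _ s0 (powR_ge0 _ _)).
  rewrite ler_wpM2r ?Phi_ge0 ?mulr_ge0 ?powR_ge0 ?(ltW a0)//.
  have [t1|t1] := leP t 1; first by rewrite (le_trans t1)// lerDl powR_ge0.
  rewrite (@le_trans _ _ (t `^ p))// ?lerDr// -{1}[t]powRr1//.
  by rewrite ler_powR// ltW.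
apply: ler_Phi; first by rewrite addr_ge0 ?mulr_ge0 ?powR_ge0// ltW.
(* Since [alpha + 1] and [p] are at least 1, [alpha + 1 <= (alpha + 1) ^ p], so the factor may enter
   the power. *)
rewrite powRM ?(le_trans _ a1)// -[X in _ + X]mul1r -mulrDl.
rewrite ler_wpM2r ?powR_ge0//.
by rewrite -{1}[_ + 1]powRr1 ?(le_trans _ a1)// ler_powR.
Qed.

(** [Phi1_scale] with factor [|t| / M] produces [|t| ^ N], which [Phi1 N t] controls. Dilations are
    thus comparable on bounded ranges, although the exponential growth excludes this globally. *)
Lemma Phi1_bounded_scale b M t : 0 <= b -> 0 < M -> `|t| <= M ->
  Phi1 N (b * t) <= Phi1 N (b * M) * N.-1`!%:R / M ^+ N * Phi1 N t.
Proof.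
move=> b0 M0 tM.
have -> : Phi1 N (b * t) = Phi1 N (`|t| / M * (b * M)).
  rewrite -[LHS]Phi1_abs -[RHS]Phi1_abs !normrM normr_id normfV (ger0_norm (ltW M0)).
  by congr Phi1; field; rewrite gt_eqF.
rewrite (le_trans (Phi1_scale _ _ _))// ?divr_ge0 ?(ltW M0)// ?ler_pdivrMr ?mul1r//.
rewrite expr_div_n mulrC -!mulrA ler_wpM2l ?Phi1_ge0// mulrCA [leLHS]mulrC.
by rewrite ler_wpM2l ?invr_ge0 ?exprn_ge0 ?(ltW M0)// expr_le_Phi1.
Qed.

Lemma measurable_Phi1 : measurable_fun [set: R] (@Phi1 R N).
Proof.
have mpow (r : R) : measurable_fun [set: R] (fun t : R => `|t| `^ r).
  apply: (measurableT_comp (measurable_powR r)); exact: normr_measurable.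
apply: measurable_funB; first exact: measurableT_comp.
apply: measurable_sum => j; apply: measurable_funM => //.
Qed.

End Phi1_theory.

(** * Modulars over an arbitrary measure *)

Section modular_theory.
Context {R : realType} {N : nat} (N3 : (3 <= N)%N).
Context {d : measure_display} {T : measurableType d}
  (mu : {measure set T -> \bar R}).
Implicit Types (u v w : T -> R) (b c : R).

(** The modular at Luxemburg parameter [1 / b]: dilations become multiplications. *)
Definition Phi1_int u b : \bar R := (\int[mu]_x (Phi1 N (b * u x))%:E)%E.

Lemma measurable_Phi1_comp u b : measurable_fun [set: T] u ->
  measurable_fun [set: T] (fun x => (Phi1 N (b * u x))%:E).
Proof.
move=> mu_; apply/measurable_EFinP; apply: (measurableT_comp (@measurable_Phi1 R N)).
exact: measurable_funM.
Qed.

Lemma Phi1_int_ge0 u b : (0 <= Phi1_int u b)%E.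
Proof. by apply: integral_ge0 => x _; rewrite lee_fin Phi1_ge0. Qed.

Lemma le_Phi1_int u v b c C : 0 <= C ->
  measurable_fun [set: T] u -> measurable_fun [set: T] v ->
  (forall x, Phi1 N (b * u x) <= C * Phi1 N (c * v x)) ->
  (Phi1_int u b <= C%:E * Phi1_int v c)%E.
Proof.
move=> C0 mu_ mv h; rewrite -ge0_integralZl_EFin//; last 2 first.
  by move=> x _; rewrite lee_fin Phi1_ge0.
  exact: measurable_Phi1_comp.
apply: ge0_le_integral => //.
- by move=> x _; rewrite lee_fin Phi1_ge0.
- exact: measurable_Phi1_comp.
- by apply: measurable_funeM; exact: measurable_Phi1_comp.
- by move=> x _; rewrite -EFinM lee_fin.
Qed.

Lemma Phi1_int_mono u b c : measurable_fun [set: T] u -> 0 <= b -> b <= c ->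
  (Phi1_int u b <= Phi1_int u c)%E.
Proof.
move=> mu_ b0 bc; rewrite -[leRHS]mul1e; apply: le_Phi1_int => // x.
rewrite mul1r ler_Phi1// !normrM ler_wpM2r// !ger0_norm//.
exact: le_trans bc.
Qed.

Lemma Phi1_int_add u v b :
  measurable_fun [set: T] u -> measurable_fun [set: T] v ->
  (Phi1_int (u \+ v)%R b <= Phi1_int u (2 * b) + Phi1_int v (2 * b))%E.
Proof.
move=> mu_ mv; rewrite -ge0_integralD//=; last 4 first.
- by move=> x _; rewrite lee_fin Phi1_ge0.
- exact: measurable_Phi1_comp.
- by move=> x _; rewrite lee_fin Phi1_ge0.
- exact: measurable_Phi1_comp.
apply: ge0_le_integral => //.
- by move=> x _; rewrite lee_fin Phi1_ge0.
- by apply: measurable_Phi1_comp; exact: measurable_funD.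
- by apply: emeasurable_funD; exact: measurable_Phi1_comp.
- by move=> x _; rewrite -EFinD lee_fin mulrDr -!mulrA Phi1_add.
Qed.

(** Scaling the argument by [s <= 1] scales [Phi1] by at most [s]. If [K] is the finite modular,
    [s = 1 / (K + 1)] leaves at most [K / (K + 1)]. *)
Lemma Phi1_int_le1 u b : measurable_fun [set: T] u -> 0 < b ->
  (Phi1_int u b < +oo)%E -> exists c, 0 < c /\ (Phi1_int u c <= 1)%E.
Proof.
move=> mu_ b0 fin.
have K0 := fine_ge0 (Phi1_int_ge0 u b); set K := fine _ in K0.
have KE : Phi1_int u b = K%:E by rewrite fineK// ge0_fin_numE// Phi1_int_ge0.
have k0 : 0 < K + 1 by rewrite ltr_wpDl.
exists ((K + 1)^-1 * b); split; first by rewrite mulr_gt0// invr_gt0.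
have k1 : (K + 1)^-1 <= 1 by rewrite invf_le1// lerDr.
have kn : 0 <= (K + 1)^-1 by rewrite invr_ge0 ltW.
apply: (@le_trans _ _ ((K + 1)^-1%:E * Phi1_int u b)%E).
  apply: le_Phi1_int => // x; rewrite -mulrA (le_trans (Phi1_scale _ _ _ _))//.
  rewrite ler_wpM2r ?Phi1_ge0// -[leRHS]expr1 ler_wiXn2l//.
  exact: leq_trans N3.
by rewrite KE -EFinM lee_fin mulrC ler_pdivrMr// mul1r lerDl.
Qed.

Lemma Phi1_int0 b : Phi1_int (fun=> 0) b = 0%E.
Proof.
rewrite /Phi1_int mulr0 (_ : Phi1 N 0 = 0) ?integral0//.
apply/eqP; rewrite eq_le Phi1_ge0// andbT.
have := @Phi1_scale R N N3 0 0 (lexx _) ler01.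
by rewrite mulr0 expr0n -[N == 0]negbK -lt0n (leq_trans _ N3)//= mul0r.
Qed.

Lemma Phi1_int_bounded u b c M : measurable_fun [set: T] u -> 0 < b -> 0 < c ->
  (forall x, `|u x| <= M) -> (Phi1_int u b < +oo)%E -> (Phi1_int u c < +oo)%E.
Proof.
(* [|M| + 1] keeps the bound strictly positive whatever the sign of [M]. *)
move=> mu_ b0 c0 uM fin; pose M' := b * (`|M| + 1).
have M'0 : 0 < M' by rewrite mulr_gt0// ltr_wpDl.
pose C := Phi1 N (c / b * M') * N.-1`!%:R / M' ^+ N.
have C0 : 0 <= C by rewrite !mulr_ge0 ?Phi1_ge0// invr_ge0 exprn_ge0// ltW.
apply: (@le_lt_trans _ _ (C%:E * Phi1_int u b)%E); last by rewrite lte_mul_pinfty.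
apply: le_Phi1_int => // x.
rewrite (_ : c * u x = c / b * (b * u x)); last by rewrite mulrA divfK// gt_eqF.
apply: Phi1_bounded_scale => //; first by rewrite divr_ge0// ltW.
rewrite normrM gtr0_norm// ler_pM2l// (le_trans (uM x))// (le_trans (ler_norm _))//.
by rewrite lerDl.
Qed.

(** The form in which membership in the Orlicz space enters the estimates; its stability under
    subtraction makes it available for the differences measured by [lux_norm]. *)
Definition fin_modular u :=
  measurable_fun [set: T] u /\ exists c, 0 < c /\ (Phi1_int u c < +oo)%E.

Lemma fin_modular_sub u v : fin_modular u -> fin_modular v -> fin_modular (u \- v).
Proof.
move=> [mu_ [b [b0 fu]]] [mv [c [c0 fv]]]; split; first exact: measurable_funB.
(* Halving offsets the doubling in [Phi1_int_add]. *)
pose e := Num.min b c / 2; have e0 : 0 < e by rewrite divr_gt0// lt_min b0.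
exists e; split; first exact: e0.
have mNv : measurable_fun [set: T] (\- v) by exact: measurableT_comp.
have e2 : 2 * e = Num.min b c by rewrite /e mulrC divfK.
have m0 : 0 <= Num.min b c by rewrite le_min !ltW.
have mb : Num.min b c <= b by rewrite ge_min lexx.
have mc : Num.min b c <= c by rewrite ge_min lexx orbT.
have Jv : (Phi1_int (\- v)%R (2 * e) < +oo)%E.
  apply: le_lt_trans fv; rewrite -[leRHS]mul1e; apply: le_Phi1_int => // x.
  by rewrite mul1r e2 ler_Phi1// !normrM normrN ler_wpM2r// !ger0_norm// ltW.
have Ju : (Phi1_int u (2 * e) < +oo)%E.
  by apply: le_lt_trans fu; rewrite e2; exact: Phi1_int_mono.
apply: (le_lt_trans (Phi1_int_add e mu_ mNv)).
exact: (lte_add_pinfty Ju Jv).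
Qed.

(** Each of the two uses of [Phi1_int_add] doubles the dilation, whence [2 * b] for [v - u] and
    [2 * (2 * b)] for [u - z] and [z]. *)
Lemma Phi1_int_near_bounded u v z b :
  measurable_fun [set: T] u -> measurable_fun [set: T] v ->
  measurable_fun [set: T] z ->
  (Phi1_int (v \- u)%R (2 * b) <= 1)%E ->
  (Phi1_int (u \- z)%R (2 * (2 * b)) <= 1)%E ->
  (Phi1_int v b <= 1 + (1 + Phi1_int z (2 * (2 * b))))%E.
Proof.
move=> mu_ mv mz Jvu Juz.
have muz : measurable_fun [set: T] (u \- z) by exact: measurable_funB.
have -> : v = (v \- u) \+ ((u \- z) \+ z).
  by apply/funext => x /=; rewrite !subrK.
apply: (le_trans (Phi1_int_add _ _ _)).
- exact: measurable_funB.
- exact: measurable_funD.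
apply: (leeD Jvu); apply: (le_trans (Phi1_int_add _ muz mz)).
exact: (leeD Juz (lexx _)).
Qed.

End modular_theory.

(** * From the Luxemburg norm to modulars *)

Section lux_theory.
Context {R : realType} {N : nat} (N3 : (3 <= N)%N).
Implicit Types (u v w : RN R N -> R).
Local Notation J := (Phi1_int (N := N) (lebN R N)).
Local Notation finJ := (fin_modular (N := N) (lebN R N)).

Lemma modular1E u lam : 0 < lam -> modular1 u lam = J u lam^-1.
Proof.
move=> l0; apply: eq_integral => x _; congr EFin.
by rewrite -[RHS]Phi1_abs normrM gtr0_norm ?invr_gt0// mulrC.
Qed.

Lemma in_LPhi1_fin_modular u : in_LPhi1 u -> finJ u.
Proof.
move=> [[mu_ _] [lam [l0]]]; rewrite (modular1E _ l0) => fin; split; first exact: mu_.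
by exists lam^-1; split; [rewrite invr_gt0 | exact: fin].
Qed.

(* [inf set0 = 0], so a Luxemburg norm is meaningful only once this is known. *)
Lemma lux_set_neq0 u : finJ u ->
  exists lam, 0 < lam /\ (modular1 u lam <= 1)%E.
Proof.
move=> [mu_ [b [b0 fin]]].
have [c [c0 h]] := Phi1_int_le1 N3 mu_ b0 fin.
have ci : 0 < c^-1 by rewrite invr_gt0.
by exists c^-1; split; [exact: ci | rewrite (modular1E _ ci) invrK; exact: h].
Qed.

(** Some admissible [lam] lies below [r], and the modular decreases as its parameter grows. *)
Lemma lux_norm_lt u r : finJ u -> lux_norm u < r ->
  0 < r /\ (J u r^-1 <= 1)%E.
Proof.
move=> fu ur; have [mu_ _] := fu.
have [lam [[l0 hl] lr]] : exists lam, (0 < lam /\ (modular1 u lam <= 1)%E) /\ lam < r.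
  have ne : [set lam : R | 0 < lam /\ (modular1 u lam <= 1)%E] !=set0.
    by have [l] := lux_set_neq0 fu; exists l.
  by have [l] := inf_lt ne ur; exists l.
have r0 := lt_trans l0 lr; split; first exact: r0.
apply: le_trans hl; rewrite (modular1E _ l0); apply: (Phi1_int_mono _ mu_).
  by rewrite invr_ge0 ltW.
by rewrite lef_pV2 ?posrE// ltW.
Qed.

Lemma lux_norm0 r : 0 < r -> @lux_norm R N (fun=> 0) < r.
Proof.
move=> r0; have r20 : 0 < r / 2 by lra.
apply: (@le_lt_trans _ _ (r / 2)); last by lra.
apply: ge_inf; first by exists 0 => l [/ltW].
split; first exact: r20.
by rewrite (modular1E _ r20) (Phi1_int0 N3); exact: lee01.
Qed.

(* [u] splits into a bounded function, whose modulars are all finite, and a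
   remainder of small norm; the perturbation [v - u] is small as well. *)
Lemma EPhi1_modular_bounded u b : in_EPhi1 u -> 0 < b ->
  exists r K : R, [/\ 0 < r, 0 <= K & forall v, finJ v ->
    lux_norm (v \- u) < r -> (J v b <= K%:E)%E].
Proof.
move=> [Lu Eu] b0; have fu := in_LPhi1_fin_modular Lu.
(* The tolerance is the reciprocal of the dilation at which [u - z] appears after two splittings. *)
have e0 : 0 < (2 * (2 * b))^-1 by rewrite invr_gt0 !mulr_gt0.
have [z [Lz [[M zM] _] uz]] := Eu _ e0.
have fz := in_LPhi1_fin_modular Lz.
have [mu_ _] := fu; have [mz [c [c0 fc]]] := fz.
have [_ Juz] := lux_norm_lt (fin_modular_sub fu fz) uz; rewrite invrK in Juz.
have b4 : 0 < 2 * (2 * b) by rewrite !mulr_gt0.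
have Jz := Phi1_int_bounded N3 mz c0 b4 zM fc.
have Jz0 := Phi1_int_ge0 (N := N) (lebN R N) z (2 * (2 * b)).
have Kz : (fine (J z (2 * (2 * b))))%:E = J z (2 * (2 * b)).
  by apply: fineK; rewrite (ge0_fin_numE Jz0); exact: Jz.
have K0 := fine_ge0 Jz0.
exists (2 * b)^-1, (1 + (1 + fine (J z (2 * (2 * b))))).
split; first by rewrite invr_gt0 mulr_gt0.
  exact: (addr_ge0 ler01 (addr_ge0 ler01 K0)).
move=> v fv vu; have [mv _] := fv.
have [_ Jvu] := lux_norm_lt (fin_modular_sub fv fu) vu; rewrite invrK in Jvu.
rewrite !EFinD Kz.
exact: (Phi1_int_near_bounded mu_ mv mz Jvu Juz).
Qed.

End lux_theory.

(** * Almost-everywhere properties on the line and essential bounds *)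

Section ae_local.
Context {R : realType}.
Local Notation lebesgue := (@lebesgue_measure R).

(* [filterS] and [filterI] do not find their instance for [lebesgue_measure]. *)
Lemma ae_lebS (P Q : R -> Prop) : (forall s, P s -> Q s) ->
  (\forall s \ae lebesgue, P s) -> \forall s \ae lebesgue, Q s.
Proof.
have F := @ae_filter_ringOfSetsType _ _ _ lebesgue.
by move=> PQ aeP; apply: (@filterS _ _ F _ _ _ aeP).
Qed.

Lemma ae_lebI (P Q : R -> Prop) : (\forall s \ae lebesgue, P s) ->
  (\forall s \ae lebesgue, Q s) -> \forall s \ae lebesgue, P s /\ Q s.
Proof.
have F := @ae_filter_ringOfSetsType _ _ _ lebesgue.
by move=> aeP aeQ; exact: (@filterI _ _ F _ _ aeP aeQ).
Qed.

(* Rational endpoints reduce the cover to a countable one. *)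
Lemma ae_local_to_global (D : set R) (P : R -> Prop) :
  (forall t, D t -> exists2 e, 0 < e &
     \forall s \ae lebesgue, `](t - e), (t + e)[%classic s -> P s) ->
  \forall s \ae lebesgue, D s -> P s.
Proof.
move=> loc.
pose good (pq : rat * rat) :=
  \forall s \ae lebesgue, `](ratr pq.1), (ratr pq.2)[%classic s -> P s.
(* A pair that is not [good] gives a vacuous clause, so every [Q n] holds almost everywhere. *)
pose Q n s := if unpickle n is Some pq then
  good pq -> `](ratr pq.1), (ratr pq.2)[%classic s -> P s else True.
have aeQ n : \forall s \ae lebesgue, Q n s.
  rewrite /Q; case: unpickle => [pq|]; last exact: aeW.
  have [gpq|ngpq] := pselect (good pq); last by apply: aeW.
  by move: (gpq); apply: ae_lebS => s h _; exact: h.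
move: (ae_foralln aeQ); apply: ae_lebS => s Qs Ds.
have [e e0 aee] := loc _ Ds.
(* The window is centred at [s] itself; the interval from [p] to [q] contains [s] and lies inside
   the window, hence is [good]. *)
have [p] := @rat_in_itvoo R (s - e) s (ltac:(lra)).
have [q] := @rat_in_itvoo R s (s + e) (ltac:(lra)).
rewrite !in_itv/= => /andP[sq qe] /andP[ep ps].
have := Qs (pickle (p, q)); rewrite /Q pickleK /=; apply.
  move: aee; apply: ae_lebS => y h; rewrite /= in_itv/= => /andP[py yq].
  by apply: h; rewrite /= in_itv/=; apply/andP; split; lra.
by rewrite in_itv/= ps sq.
Qed.

(** An essential lower bound not below some essential upper bound would make the interval
    negligible, against its length [b - a > 0]. *)
Lemma essinf_le_esssup (g : R -> R) (a b : R) : a < b ->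
  (essinf_on `]a, b[%classic g <= esssup_on `]a, b[%classic g)%E.
Proof.
move=> ab; apply: ge_ereal_sup => y1 aey1; apply: le_ereal_inf_tmp => y2 aey2.
apply: contrapT => ny.
have [A [mA A0 h]] : lebesgue.-negligible `]a, b[%classic.
  have := ae_lebI aey1 aey2; apply: negligibleS => s Ds [h1 h2].
  by apply: ny; exact: le_trans (h1 Ds) (h2 Ds).
have : (lebesgue `]a, b[%classic <= lebesgue A)%E by apply: le_measure; rewrite ?inE.
rewrite [X in (_ <= X)%E]A0 lebesgue_measure_itv/= lte_fin ab -EFinD lee_fin subr_le0.
by rewrite leNgt ab.
Qed.

Lemma le_esssup_on (g : R -> R) (A B : set R) : A `<=` B ->
  (esssup_on A g <= esssup_on B g)%E.
Proof.
move=> AB; apply: ereal_inf_le_tmp => y; apply: ae_lebS => s h As.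
by apply: h; exact: AB.
Qed.

Lemma le_essinf_on (g : R -> R) (A B : set R) : A `<=` B ->
  (essinf_on B g <= essinf_on A g)%E.
Proof.
move=> AB; apply: ereal_sup_le => y; apply: ae_lebS => s h As.
by apply: h; exact: AB.
Qed.

End ae_local.

(** * The generalized gradient and the almost-everywhere bound on [f x] drawn from it *)

Section generalized_gradient.
Context {R : realType} {N : nat} (f : RN R N -> R -> R).
Implicit Types (x : RN R N) (t : R).
Local Notation lebesgue := (@lebesgue_measure R).
Local Notation win t e := (`](t - e), (t + e)[%classic : set R).

Let sub_win t (e e' : R) : e <= e' -> win t e `<=` win t e'.
Proof.
move=> ee s; rewrite /= !in_itv/= => /andP[h1 h2].
by apply/andP; split; lra.
Qed.

(** The essential supremum is monotone in the radius, so [lim] is a genuine limit and equals the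
    infimum. *)
Lemma f_upE x t :
  f_up f x t = ereal_inf [set esssup_on (win t e) (f x) | e in `]0, 1[].
Proof.
apply/cvg_lim => //; apply: nondecreasing_at_right_cvge; first by rewrite bnd_simp.
by move=> e e' _ _ ee; apply: le_esssup_on; exact: sub_win.
Qed.

Lemma f_lowE x t :
  f_low f x t = ereal_sup [set essinf_on (win t e) (f x) | e in `]0, 1[].
Proof.
apply/cvg_lim => //; apply: nonincreasing_at_right_cvge; first by rewrite bnd_simp.
by move=> e e' _ _ ee; apply: le_essinf_on; exact: sub_win.
Qed.

Lemma f_low_le_up x t : (f_low f x t <= f_up f x t)%E.
Proof.
rewrite f_upE f_lowE; apply: ge_ereal_sup => _ [e1 h1 <-].
apply: le_ereal_inf_tmp => _ [e2 h2 <-].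
move: h1 h2; rewrite /= !in_itv/= => /andP[e10 _] /andP[e20 _].
pose e := Num.min e1 e2; have e0 : 0 < e by rewrite lt_min e10.
apply: (@le_trans _ _ (essinf_on (win t e) (f x))).
  by apply: le_essinf_on; apply: sub_win; rewrite ge_min lexx.
apply: (@le_trans _ _ (esssup_on (win t e) (f x))).
  by apply: essinf_le_esssup; lra.
by apply: le_esssup_on; apply: sub_win; rewrite ge_min lexx orbT.
Qed.

Hypothesis f_locb : locally_bounded f.

(** (f6) tests real [xi] only; finiteness makes the endpoints of the gradient eligible. *)
Lemma f_low_up_fin x t : f_low f x t \is a fin_num /\ f_up f x t \is a fin_num.
Proof.
(* This radius covers [x] and every [s] within 1/2 of [t]; the [+ 1] also makes it positive. *)
have r0 : 0 < Num.max (eucl x) (`|t| + 1).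
  by rewrite lt_max; apply/orP; right; rewrite ltr_wpDl.
have [M hM] := f_locb r0.
have h2 : `]0, 1[%classic (2^-1 : R) by rewrite /= in_itv/=; apply/andP; split; lra.
have bnd s : win t 2^-1 s -> `|f x s| <= M.
  rewrite /= in_itv/= => /andP[h1 h3]; apply: hM; first by rewrite le_max lexx.
  rewrite le_max; apply/orP; right.
  have := ler_norm t; have := ler_norm (- t); rewrite normrN ler_norml => *.
  by apply/andP; split; lra.
have up : (f_up f x t <= M%:E)%E.
  rewrite f_upE; apply: ge_ereal_inf; exists (esssup_on (win t 2^-1) (f x)).
    by exists 2^-1.
  apply: ereal_inf_lbound; apply: aeW => s ws; rewrite lee_fin.
  by rewrite (le_trans (ler_norm _))// bnd.
have low : ((- M)%:E <= f_low f x t)%E.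
  rewrite f_lowE; apply: le_ereal_sup_tmp; exists (essinf_on (win t 2^-1) (f x)).
    by exists 2^-1.
  apply: ereal_sup_ubound; apply: aeW => s ws; rewrite lee_fin.
  by have := bnd _ ws; rewrite ler_norml => /andP[].
have lu := f_low_le_up x t.
split; rewrite fin_numE; apply/andP; split.
- by rewrite gt_eqF// (lt_le_trans _ low)// ltNyr.
- by rewrite lt_eqF// (le_lt_trans lu)// (le_lt_trans up)// ltry.
- by rewrite gt_eqF// (lt_le_trans _ lu)// (lt_le_trans _ low)// ltNyr.
- by rewrite lt_eqF// (le_lt_trans up)// ltry.
Qed.

(** Both endpoints are admissible values of [xi], since they are finite and ordered. *)
Lemma gradient_bound x t K :
  (forall xi : R, (f_low f x t <= xi%:E)%E -> (xi%:E <= f_up f x t)%E -> `|xi| <= K) ->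
  ((- K)%:E <= f_low f x t)%E /\ (f_up f x t <= K%:E)%E.
Proof.
move=> h; have [lfin ufin] := f_low_up_fin x t; have lu := f_low_le_up x t.
split.
  have := h (fine (f_low f x t)); rewrite fineK// => /(_ (lexx _) lu).
  by rewrite ler_norml -[f_low f x t]fineK// lee_fin => /andP[].
have := h (fine (f_up f x t)); rewrite fineK// => /(_ lu (lexx _)).
by rewrite ler_norml -[f_up f x t]fineK// lee_fin => /andP[].
Qed.

(** The slack [e] gives each point a window on which the essential bounds are within [K + e];
    [ae_local_to_global] glues these windows. *)
Lemma ae_abs_le_of_gradient (D : set R) x K :
  (forall t, D t -> ((- K)%:E <= f_low f x t)%E /\ (f_up f x t <= K%:E)%E) ->
  forall e, 0 < e -> \forall s \ae lebesgue, D s -> `|f x s| <= K + e.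
Proof.
move=> h e e0; apply: ae_local_to_global => t /h[lowK upK].
have : (f_up f x t < (K + e)%:E)%E by rewrite (le_lt_trans upK)// lte_fin ltrDl.
(* The outer infimum yields a radius, the inner one an almost-everywhere bound on that window. *)
rewrite f_upE => /ereal_inf_lt[_ [d1 hd1 <-]] /ereal_inf_lt[y1 aey1 hy1].
have : ((- (K + e))%:E < f_low f x t)%E.
  by rewrite (lt_le_trans _ lowK)// lte_fin ltrN2 ltrDl.
rewrite f_lowE => /ereal_sup_gt[_ [d2 hd2 <-]] /ereal_sup_gt[y2 aey2 hy2].
move: hd1 hd2; rewrite /= !in_itv/= => /andP[d10 _] /andP[d20 _].
exists (Num.min d1 d2); first by rewrite lt_min d10.
have := ae_lebI aey1 aey2; apply: ae_lebS => s [h1 h2] ws.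
rewrite ler_norml; apply/andP; split.
  rewrite -lee_fin; apply: le_trans (ltW hy2) (h2 _).
  by apply: sub_win ws; rewrite ge_min lexx orbT.
rewrite -lee_fin; apply: le_trans (ltW hy1); apply: h1.
by apply: sub_win ws; rewrite ge_min lexx.
Qed.

End generalized_gradient.

(** * The length estimate for integrals over an interval *)

Section interval_integral.
Context {R : realType}.
Local Notation lebesgue := (@lebesgue_measure R).
Implicit Types (g : R -> R) (a b K : R).

Lemma abs_Rintegral_itv_le g a b K : a <= b ->
  lebesgue.-integrable `[a, b]%classic (EFin \o g) ->
  (\forall s \ae lebesgue, `[a, b]%classic s -> `|g s| <= K) ->
  `|Rintegral lebesgue `[a, b]%classic g| <= K * (b - a).
Proof.
move=> ab ig aeg.
have mitv : measurable `[a, b]%classic by exact: measurable_itv.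
have mg : measurable_fun `[a, b]%classic (EFin \o g) by exact: measurable_int ig.
(* A negative [K] forces the interval to be null, so [a = b] and both sides vanish. *)
have [K0|K0] := leP 0 K; last first.
  have N : (lebesgue `[a, b]%classic = 0)%E.
    apply: (@measure_negligible _ _ _ lebesgue) => //.
    apply: negligibleS aeg => s h1 h2.
    by have := le_lt_trans (h2 h1) K0; rewrite ltNge normr_ge0.
  rewrite (_ : Rintegral _ _ _ = 0); last by rewrite /Rintegral null_set_integral.
  move: N; rewrite lebesgue_measure_itv/= lte_fin.
  case: ltP => [ab'|ba] => [|_].
    by rewrite -EFinD => -[/eqP]; rewrite subr_eq0 gt_eqF.
  by rewrite normr0 (_ : b - a = 0) ?mulr0//; apply/eqP; rewrite subr_eq0 eq_le ab ba.
rewrite -lee_fin EFin_normr_Rintegral//.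
apply: (le_trans (le_abse_integral _ _ _)) => //.
apply: (@le_trans _ _ (\int[lebesgue]_(s in `[a, b]) K%:E)%E).
  by apply: ae_ge0_le_integral => //; exact: measurableT_comp.
rewrite integral_cst//= lebesgue_measure_itv/= lte_fin.
case: ltP => [_|ba]; first by rewrite -EFinD -EFinM.
by rewrite mule0 lee_fin mulr_ge0// subr_ge0.
Qed.

End interval_integral.

(** * The primitive [F(x, .)] and its Lipschitz bound on bounded intervals *)

Section primitive.
Context {R : realType} {N : nat} (f : RN R N -> R -> R) (x : RN R N).
Local Notation lebesgue := (@lebesgue_measure R).
Hypothesis f_meas : measurable_fun [set: R] (f x).
Hypothesis f_locb : locally_bounded f.
Implicit Types (a b K M : R).

Lemma integrable_section a b : lebesgue.-integrable `[a, b]%classic (EFin \o f x).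
Proof.
have fin : (lebesgue `[a, b]%classic < +oo)%E.
  by rewrite lebesgue_measure_itv/=; case: ifP => // _; rewrite -EFinD ltry.
apply: (measurable_bounded_integrable _ fin).
- exact: measurable_itv.
- exact: measurable_funTS.
have r0 : 0 < Num.max (eucl x) (`|a| + `|b| + 1).
  by rewrite lt_max; apply/orP; right; rewrite ltr_wpDl// addr_ge0.
have [M hM] := f_locb r0.
exists M; split; first exact: num_real.
move=> M' MM' s; rewrite /= in_itv/= => /andP[as_ sb].
apply: le_trans (ltW MM'); apply: hM; first by rewrite le_max lexx.
rewrite le_max; apply/orP; right.
have := ler_norm b; have := ler_norm (- a); rewrite normrN ler_norml => *.
have := normr_ge0 a; have := normr_ge0 b.
by move=> *; apply/andP; split; lra.
Qed.

Lemma Rintegral_section_split a b c : a <= b -> b <= c ->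
  Rintegral lebesgue `[a, c]%classic (f x) =
  Rintegral lebesgue `[a, b]%classic (f x) + Rintegral lebesgue `[b, c]%classic (f x).
Proof.
move=> ab bc; have := @Rintegral_itvB R (f x) (BLeft a) (BRight c) b.
rewrite !bnd_simp => /(_ (integrable_section a c) ab bc).
rewrite Rintegral_itv_obnd_cbnd; last first.
  apply: integrableS (integrable_section b c) => //.
  by move=> s; rewrite /= !in_itv/= => /andP[/ltW -> ->].
by move=> <-; rewrite addrC subrK.
Qed.

Lemma Fprim_sub a b : a <= b ->
  Fprim f x b - Fprim f x a = Rintegral lebesgue `[a, b]%classic (f x).
Proof.
move=> ab; rewrite /Fprim; have [b0|b0] := leP 0 b; have [a0|a0] := leP 0 a.
- by rewrite (Rintegral_section_split a0 ab) addrAC subrr add0r.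
- by rewrite (Rintegral_section_split (ltW a0) b0) opprK addrC.
- by have := lt_le_trans b0 (le_trans a0 ab); rewrite ltxx.
- rewrite (Rintegral_section_split ab (ltW b0)) opprK addrC.
  by rewrite -addrA subrr addr0.
Qed.

Lemma Fprim_lipschitz M K a b : `|a| <= M -> `|b| <= M ->
  (forall e, 0 < e -> \forall s \ae lebesgue, `[- M, M]%classic s -> `|f x s| <= K + e) ->
  `|Fprim f x a - Fprim f x b| <= K * `|a - b|.
Proof.
wlog ab : a b / b <= a.
  move=> h aM bM aeK; have [ba|/ltW ab] := leP b a; first exact: h.
  by rewrite distrC [`|a - b|]distrC; exact: h.
rewrite ler_norml => /andP[_ aM]; rewrite ler_norml => /andP[bM _] aeK.
rewrite Fprim_sub// (ger0_norm (_ : 0 <= a - b)) ?subr_ge0//.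
apply/ler_addgt0Pr => e e0.
(* Multiplied by [a - b], this slack stays below [e]; the [+ 1] covers the case [a = b]. *)
have e'0 : 0 < e / (a - b + 1) by rewrite divr_gt0// ltr_wpDl// subr_ge0.
apply: (@le_trans _ _ ((K + e / (a - b + 1)) * (a - b))).
  apply: abs_Rintegral_itv_le => //; first exact: integrable_section.
  move: (aeK _ e'0); apply: ae_lebS => s h; rewrite /= in_itv/= => /andP[bs sa].
  by apply: h; rewrite /= in_itv/=; apply/andP; split; lra.
rewrite mulrDl lerD2l mulrAC ler_pdivrMr; last by rewrite ltr_wpDl// subr_ge0.
by rewrite ler_pM2l// lerDl.
Qed.

Lemma Fprim0 : Fprim f x 0 = 0.
Proof. by rewrite /Fprim lexx set_itv1 Rintegral_set1. Qed.

End primitive.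

(** * Measurability of [x -> F(x, u(x))] *)

Section measurability.
Context {R : realType} {d : measure_display} {T : measurableType d}.
Context (f : T -> R -> R).
Local Notation lebesgue := (@lebesgue_measure R).
Hypothesis f_meas : measurable_fun [set: (T * R)%type] (fun p => f p.1 p.2).

Lemma measurable_section (x : T) : measurable_fun [set: R] (f x).
Proof. exact: (measurable_fun_pair2 x f_meas). Qed.

(** The moving endpoints become a cut-off of the integrand on the product space; Tonelli then
    applies to its positive and negative parts. *)
Lemma measurable_Rintegral_itv (a b : T -> R) :
  measurable_fun [set: T] a -> measurable_fun [set: T] b ->
  measurable_fun [set: T] (fun x => Rintegral lebesgue `[a x, b x]%classic (f x)).
Proof.
move=> ma mb.
pose h (p : T * measurableTypeR R) : \bar R :=
  (if (a p.1 <= p.2) && (p.2 <= b p.1) then f p.1 p.2 else 0)%:E.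
have mh : measurable_fun [set: (T * measurableTypeR R)%type] h.
  apply/measurable_EFinP; apply: measurable_fun_ifT => //.
  apply: measurable_and; apply: measurable_fun_ler => //.
  - exact: (measurableT_comp ma).
  - exact: (measurableT_comp mb).
rewrite (_ : (fun x => _) =
    fine \o (fun x => fubini_F lebesgue h^\+ x - fubini_F lebesgue h^\- x)%E).
  apply: measurableT_comp; first exact: fine_measurable.
  apply: emeasurable_funB.
  - apply: measurable_fun_fubini_tonelli_F => //.
    exact: measurable_funepos.
  - apply: measurable_fun_fubini_tonelli_F => //.
    exact: measurable_funeneg.
apply/funext => x; rewrite /Rintegral /= integral_mkcond.
have -> : (fun s => (f x s)%:E) \_ `[a x, b x] = (fun s => h (x, s)).
  by apply/funext => s; rewrite /patch mem_setE in_itv/= /h /=; case: ifP.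
rewrite integralE /fubini_F; congr (fine (_ - _)%E); apply: eq_integral => s _.
  by rewrite !funeposE.
by rewrite !funenegE.
Qed.

End measurability.

Lemma measurable_Fprim {R : realType} {N : nat} (f : RN R N -> R -> R) (u : RN R N -> R) :
  measurable_fun [set: (RN R N * R)%type] (fun p => f p.1 p.2) ->
  measurable_fun [set: RN R N] u ->
  measurable_fun [set: RN R N] (fun x => Fprim f x (u x)).
Proof.
move=> mf mu_; rewrite /Fprim; apply: measurable_fun_ifT.
- by apply: measurable_fun_ler.
- exact: measurable_Rintegral_itv.
- by apply: measurableT_comp => //; exact: measurable_Rintegral_itv.
Qed.

(** * Integrals controlled by modulars *)

Section integral_comparison.
Context {R : realType} {N : nat} {d : measure_display} {T : measurableType d}
  (mu : {measure set T -> \bar R}).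
Implicit Types (A B h v w : T -> R) (b c l K : R).
Local Notation J := (Phi1_int (N := N) mu).

Lemma integrable_le_Phi1 A v b c : 0 <= c ->
  measurable_fun [set: T] A -> measurable_fun [set: T] v ->
  (forall x, `|A x| <= c * Phi1 N (b * v x)) -> (J v b < +oo)%E ->
  mu.-integrable [set: T] (fun x => (A x)%:E).
Proof.
move=> c0 mA mv Av Jv; have mJ := measurable_Phi1_comp (N := N) b mv.
have Phi0 y : (0 <= (Phi1 N (b * v y))%:E)%E by rewrite lee_fin Phi1_ge0.
apply/integrableP; split; first exact/measurable_EFinP.
apply: (@le_lt_trans _ _ (c%:E * J v b)%E); last exact: lte_mul_pinfty.
rewrite -ge0_integralZl_EFin//; apply: ge0_le_integral => //.
- by apply: measurableT_comp => //; exact/measurable_EFinP.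
- exact: measurable_funeM.
- by move=> x _; rewrite -EFinM lee_fin Av.
Qed.

(** Integrating the pointwise bound turns its three terms into modulars bounded by 1, [K] and [K].
    The intended [h] is [v - w], with [l] the reciprocal of an admissible Luxemburg parameter. *)
Lemma abs_RintegralB_le A B h v w l b c K : 0 <= c ->
  mu.-integrable [set: T] (fun x => (A x)%:E) ->
  mu.-integrable [set: T] (fun x => (B x)%:E) ->
  measurable_fun [set: T] h -> measurable_fun [set: T] v ->
  measurable_fun [set: T] w ->
  (forall x, `|A x - B x| <=
     c * (Phi1 N (l * h x) + (Phi1 N (b * v x) + Phi1 N (b * w x)))) ->
  (J h l <= 1)%E -> (J v b <= K%:E)%E -> (J w b <= K%:E)%E ->
  `|Rintegral mu [set: T] A - Rintegral mu [set: T] B| <= c * (1 + (K + K)).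
Proof.
move=> c0 iA iB mh mv mw AB Jh Jv Jw.
have mJ b' u : measurable_fun [set: T] u ->
  measurable_fun [set: T] (fun x => (Phi1 N (b' * u x))%:E).
  exact: measurable_Phi1_comp.
have Phi0 b' u (y : T) : (0 <= (Phi1 N (b' * u y))%:E)%E by rewrite lee_fin Phi1_ge0.
have iAB : mu.-integrable [set: T] (fun x => (A x - B x)%:E).
  by have := integrableB measurableT iA iB; apply: eq_integrable.
rewrite -RintegralB// -lee_fin EFin_normr_Rintegral//.
have mAB := measurable_int mu iAB.
apply: (le_trans (le_abse_integral _ measurableT mAB)).
have mVW : measurable_fun [set: T]
    (fun x => (Phi1 N (b * v x))%:E + (Phi1 N (b * w x))%:E)%E.
  by apply: emeasurable_funD; exact: mJ.
have mS : measurable_fun [set: T] (fun x => (Phi1 N (l * h x))%:E +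
    ((Phi1 N (b * v x))%:E + (Phi1 N (b * w x))%:E))%E.
  by apply: emeasurable_funD; [exact: mJ | exact: mVW].
have JE : (\int[mu]_x (c%:E * ((Phi1 N (l * h x))%:E +
    ((Phi1 N (b * v x))%:E + (Phi1 N (b * w x))%:E))) =
    c%:E * (J h l + (J v b + J w b)))%E.
  rewrite ge0_integralZl_EFin//; last by move=> x _; rewrite !adde_ge0.
  rewrite (ge0_integralD mu measurableT (fun x _ => Phi0 l h x) (mJ l h mh)
    (fun x _ => adde_ge0 (Phi0 b v x) (Phi0 b w x)) mVW).
  by rewrite (ge0_integralD mu measurableT (fun x _ => Phi0 b v x) (mJ b v mv)
    (fun x _ => Phi0 b w x) (mJ b w mw)).
apply: (@le_trans _ _ (c%:E * (J h l + (J v b + J w b)))%E); last first.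
  rewrite EFinM !EFinD; apply: lee_wpmul2l; first by rewrite lee_fin.
  exact: (leeD Jh (leeD Jv Jw)).
rewrite -JE; apply: ge0_le_integral => //.
- exact: measurableT_comp.
- exact: measurable_funeM.
- by move=> x _; rewrite -!EFinD -EFinM lee_fin AB.
Qed.

End integral_comparison.

(** * Consequences of (f6) for [F] and [Upsilon] *)

Section growth.
Context {R : realType} {N : nat} (N3 : (3 <= N)%N) (f : RN R N -> R -> R).
Context (alpha c1 c2 : R) (alpha0 : 0 < alpha) (c10 : 0 < c1) (c20 : 0 < c2).
Hypothesis f_meas : measurable_fun [set: (RN R N * R)%type] (fun p => f p.1 p.2).
Hypothesis f_locb : locally_bounded f.
Local Notation growth t :=
  (c1 * t ^+ N.-1 + c2 * Phi N (alpha * t `^ (N%:R / (N.-1)%:R))).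
Hypothesis f_growth : forall (x : RN R N) (t xi : R),
  (f_low f x t <= xi%:E)%E -> (xi%:E <= f_up f x t)%E -> `|xi| <= growth `|t|.
Implicit Types (x : RN R N) (a b s t l : R).

Let beta := alpha + 1.
Let C := c1 * N.-1`!%:R + c2.

Let beta0 : 0 < beta. Proof. by rewrite addr_gt0. Qed.

Let C0 : 0 < C. Proof. by rewrite ltr_wpDl// mulr_ge0// ltW. Qed.

Let ler_growth s t : 0 <= s -> s <= t -> growth s <= growth t.
Proof.
move=> s0 st; have t0 := le_trans s0 st; have pw := powR_ge0 s (N%:R / N.-1%:R).
rewrite lerD// ler_pM2l//; first by rewrite lerXn2r.
rewrite ler_Phi ?mulr_ge0 ?(ltW alpha0)// ler_pM2l//.
by rewrite ge0_ler_powR ?nnegrE// divr_ge0.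
Qed.

Let growth_ge0 t : 0 <= t -> 0 <= growth t.
Proof.
move=> t0; rewrite addr_ge0// mulr_ge0 ?(ltW c10) ?(ltW c20) ?exprn_ge0//.
by rewrite Phi_ge0// mulr_ge0 ?powR_ge0// ltW.
Qed.

(** As [growth] is increasing, its value at the maximum [M] bounds the gradient on all of
    [[- M, M]]. *)
Lemma Fprim_growth x a b : `|Fprim f x a - Fprim f x b| <=
  growth (Num.max `|a| `|b|) * `|a - b|.
Proof.
set M := Num.max _ _.
apply: (@Fprim_lipschitz _ _ f x (measurable_section f_meas x) f_locb M).
- by rewrite le_max lexx.
- by rewrite le_max lexx orbT.
apply: (ae_abs_le_of_gradient (f := f) (x := x)) => t.
rewrite /= in_itv/= => tM; apply: (gradient_bound f_locb) => xi lo up.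
by rewrite (le_trans (f_growth lo up))// ler_growth// ler_norml.
Qed.

(* With [k = |a - b| / (beta l)] and [M = max |a| |b|], both [k] and [M] are at
   most [t = max k M], so that [k * growth M <= t * growth t]. *)
Lemma Fprim_Phi1_bound x a b l : 0 < l -> `|Fprim f x a - Fprim f x b| <=
  beta * l * C * (Phi1 N (l^-1 * (a - b)) + (Phi1 N (beta * a) + Phi1 N (beta * b))).
Proof.
move=> l0; apply: (le_trans (Fprim_growth _ _ _)).
set M := Num.max _ _; pose k := `|a - b| / (beta * l).
have bl0 : 0 < beta * l by rewrite mulr_gt0.
have k0 : 0 <= k by rewrite divr_ge0// ltW.
have M0 : 0 <= M by rewrite le_max normr_ge0.
have -> : `|a - b| = beta * l * k by rewrite mulrC divfK// gt_eqF.
rewrite mulrC -(mulrA _ k) -(mulrA _ C) ler_pM2l//.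
pose t := Num.max k M.
have kt : k <= t by rewrite le_max lexx.
have Mt : M <= t by rewrite le_max lexx orbT.
have t0 := le_trans k0 kt.
apply: (@le_trans _ _ (t * growth t)).
  by apply: ler_pM => //; [exact: growth_ge0 | exact: ler_growth].
apply: (le_trans (growth_le_Phi1 N3 alpha0 (ltW c10) (ltW c20) t0)).
rewrite ler_pM2l// -/beta.
(* The [beta] in the denominator of [k] cancels here and leaves the scale [l^-1]. *)
have kE : Phi1 N (beta * k) = Phi1 N (l^-1 * (a - b)).
  rewrite -[RHS]Phi1_abs normrM (gtr0_norm (_ : 0 < l^-1)) ?invr_gt0// /k.
  by congr Phi1; field; rewrite !gt_eqF.
have ME : Phi1 N (beta * M) <= Phi1 N (beta * a) + Phi1 N (beta * b).
  apply: le_trans (Phi1_max _ _); apply: ler_Phi1.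
  rewrite !normrM !(gtr0_norm beta0) -maxr_pMr ?(ltW beta0)// -/M.
  by rewrite !ger0_norm// mulr_ge0// ltW.
rewrite /t; case: (leP k M) => _.
  by rewrite (le_trans ME)// lerDr Phi1_ge0.
by rewrite kE lerDl addr_ge0 ?Phi1_ge0.
Qed.

Lemma Fprim_integrable u : in_EPhi1 u ->
  (lebN R N).-integrable [set: RN R N] (fun x => (Fprim f x (u x))%:E).
Proof.
move=> Eu; have [r [K [r0 _ hK]]] := EPhi1_modular_bounded N3 Eu beta0.
have fu := in_LPhi1_fin_modular (proj1 Eu); have [mu_ _] := fu.
(* The centre [u] belongs to its own ball. *)
have Ju : (Phi1_int (N := N) (lebN R N) u beta <= K%:E)%E.
  apply: (hK _ fu); rewrite (_ : u \- u = fun=> 0); first exact: lux_norm0.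
  by apply/funext => x /=; rewrite subrr.
have c0 : 0 <= C * 3 by rewrite mulr_ge0// ltW.
apply: (integrable_le_Phi1 c0 (measurable_Fprim f_meas mu_) mu_ _
  (le_lt_trans Ju (ltry _))) => x.
(* Comparison with [F(x, 0) = 0]. For [l = beta^-1] the prefactor [beta * l] is 1 and every scale is
   [beta]; three terms, each at most [Phi1 N (beta * u x)], give the constant [C * 3]. *)
have := @Fprim_Phi1_bound x (u x) 0 beta^-1; rewrite invr_gt0 => /(_ beta0).
rewrite (Fprim0 f x) !subr0 invrK divff ?gt_eqF// mul1r => h.
apply: (le_trans h); rewrite -mulrA ler_pM2l// mulr0.
have : Phi1 N 0 <= Phi1 N (beta * u x) by rewrite ler_Phi1// normr0.
lra.
Qed.

(** The difference is at most [l * L] for every [l] admissible in the norm of [v - w]; the infimum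
    over [l] gives the norm itself. *)
Lemma Upsilon_locally_lipschitz u : in_EPhi1 u ->
  exists r L : R, [/\ 0 < r, 0 <= L & forall v w, in_EPhi1 v -> in_EPhi1 w ->
    lux_norm (v \- u) < r -> lux_norm (w \- u) < r ->
    `|Upsilon f v - Upsilon f w| <= L * lux_norm (v \- w)].
Proof.
move=> Eu; have [r [K [r0 K0 hK]]] := EPhi1_modular_bounded N3 Eu beta0.
pose L := beta * C * (1 + (K + K)).
have L0 : 0 < L by rewrite !mulr_gt0// ltr_pwDl// addr_ge0.
exists r, L; split; [exact: r0 | exact: ltW |] => v w Ev Ew vr wr.
have fv := in_LPhi1_fin_modular (proj1 Ev).
have fw := in_LPhi1_fin_modular (proj1 Ew).
have fvw := fin_modular_sub fv fw.
have [mv _] := fv; have [mw _] := fw; have [mvw _] := fvw.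
have Jv := hK _ fv vr; have Jw := hK _ fw wr.
have iv := Fprim_integrable Ev; have iw := Fprim_integrable Ew.
rewrite mulrC -ler_pdivrMr//; apply: lb_le_inf.
  by have [l hl] := lux_set_neq0 N3 fvw; exists l.
move=> l [l0]; rewrite (modular1E _ l0) => Jl; rewrite ler_pdivrMr//.
have c0 : 0 <= beta * l * C by rewrite !mulr_ge0// ltW.
have -> : l * L = beta * l * C * (1 + (K + K)) by rewrite /L; ring.
apply: (abs_RintegralB_le c0 iv iw mvw mv mw _ Jl Jv Jw) => x.
exact: Fprim_Phi1_bound.
Qed.

End growth.

(** Well-definedness is expressed as integrability, because [Rintegral] assigns a value to every
    function. *)
Theorem theorem3p1 (R : realType) (N : nat) (hN : (3 <= N)%N)
  (f : RN R N -> R -> R)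
  (f_meas : measurable_fun [set: (RN R N * R)%type] (fun p => f p.1 p.2))
  (f_locb : locally_bounded f)
  (f6 : cond_f6 f) :
  (forall u : RN R N -> R, in_EPhi1 u ->
     (lebN R N).-integrable [set: RN R N] (fun x => (Fprim f x (u x))%:E)) /\
  (forall u : RN R N -> R, in_EPhi1 u ->
     exists r L : R, [/\ 0 < r, 0 <= L &
       forall v w : RN R N -> R, in_EPhi1 v -> in_EPhi1 w ->
         lux_norm (v \- u) < r -> lux_norm (w \- u) < r ->
         `|Upsilon f v - Upsilon f w| <= L * lux_norm (v \- w)]).
Proof.
have [alpha [c1 [c2 [alpha0 c10 c20 growth]]]] := f6.
split=> u Eu; first exact: (Fprim_integrable hN alpha0 c10 c20 f_meas f_locb growth).
exact: (Upsilon_locally_lipschitz hN alpha0 c10 c20 f_meas f_locb growth).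
Qed.
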